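(* Let $G=(V,P,d)$ be a reversible metric Markov chain with non-negative Ollivier Ricci curvature. Then \[ \alpha_{\operatorname{spectral}}\ge\frac{P_0}{16\operatorname{diam}(G)^2}. \]
   Context: $V$ finite; $P$ with symmetric support; $x\sim y$ iff $x\ne y$, $P(x,y)>0$; $d$ is a finite path distance ($d(x,y)=\inf\sum d(x_{k-1},x_k)$ over paths $x=x_0\sim\dots\sim x_n=y$); $m$ is the probability with $m(x)P(x,y)=m(y)P(y,x)$. $\Delta f(x)=\sum_yP(x,y)(f(y)-f(x))$, $\langle f,g\rangle=\sum fgm$, $\|f\|_2=\langle f,f\rangle^{1/2}$, $\mathcal E(f,g)=-\langle\Delta f,g\rangle$. $\operatorname{Lip}(1)=\{f:|f(y)-f(x)|\le d(x,y)\}$; Ollivier curvature $\kappa(x,y)=\inf\{(\Delta f(x)-\Delta f(y))/d(x,y): f\in\operatorname{Lip}(1), f(y)-f(x)=d(x,y)\}$, assumed $\ge0$ for all $x\sim y$. $P_0=\inf_{x\sim y}P(x,y)d(x,y)^2$; $\operatorname{diam}(G)=\max_{x,y}d(x,y)$. For nonempty $X\subsetneq V$, $\lambda_X=\inf\{\mathcal E(f,f):\|f\|_2=1, f|_{V\setminus X}=0\}$; $\theta(s,t)=(s-t)/(\log s-\log t)$, $\theta(s,s)=s$; $\alpha_{\operatorname{spectral}}=\inf_X\theta(\lambda_X,\lambda_{V\setminus X})$ over nonempty proper $X\subset V$. *)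

(* Defs.v *)
From HB Require Import structures.
From mathcomp Require Import all_boot all_order all_algebra.
From mathcomp Require Import all_classical all_reals.
From mathcomp Require Import exp.

Set Implicit Arguments.
Unset Strict Implicit.
Unset Printing Implicit Defensive.

Import Order.TTheory GRing.Theory Num.Theory.
Local Open Scope ring_scope.
Local Open Scope classical_set_scope.

Section Defs.
Variables (R : realType) (V : finType).

Definition markov_kernel (P : V -> V -> R) : Prop :=
  (forall x y, 0 <= P x y) /\ (forall x, \sum_(y : V) P x y = 1).

Definition symmetric_support (P : V -> V -> R) : Prop :=
  forall x y, 0 < P x y -> 0 < P y x.

Definition adj (P : V -> V -> R) : rel V := fun x y => (x != y) && (0 < P x y).

Definition path_length (d : V -> V -> R) (x : V) (p : seq V) : R :=
  \sum_(r <- pairmap d x p) r.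

Definition path_distance (P : V -> V -> R) (d : V -> V -> R) : Prop :=
  (forall x y, d x y = d y x) /\
  (forall x y, x != y -> 0 < d x y) /\
  (forall x y, d x y =
     inf [set l | exists p : seq V,
            [/\ path (adj P) x p, last x p = y & l = path_length d x p]]).

Definition reversible_probability (P : V -> V -> R) (m : V -> R) : Prop :=
  [/\ forall x, 0 <= m x, \sum_(x : V) m x = 1 &
      forall x y, m x * P x y = m y * P y x].

Definition Lap (P : V -> V -> R) (f : V -> R) (x : V) : R :=
  \sum_(y : V) P x y * (f y - f x).

Definition inner (m : V -> R) (f g : V -> R) : R := \sum_(x : V) f x * g x * m x.

Definition norm2 (m : V -> R) (f : V -> R) : R := Num.sqrt (inner m f f).

Definition energy (P : V -> V -> R) (m : V -> R) (f g : V -> R) : R :=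
  - inner m (Lap P f) g.

Definition Lip1 (d : V -> V -> R) (f : V -> R) : Prop :=
  forall x y, `|f y - f x| <= d x y.

Definition kappa (P : V -> V -> R) (d : V -> V -> R) (x y : V) : R :=
  inf [set r | exists f : V -> R,
         [/\ Lip1 d f, f y - f x = d x y &
             r = (Lap P f x - Lap P f y) / d x y]].

Definition P0 (P : V -> V -> R) (d : V -> V -> R) : R :=
  inf [set r | exists x y, adj P x y /\ r = P x y * d x y ^+ 2].

Definition diam (d : V -> V -> R) : R :=
  \big[Num.max/0]_(x : V) \big[Num.max/0]_(y : V) d x y.

Definition lambdaD (P : V -> V -> R) (m : V -> R) (X : {set V}) : R :=
  inf [set r | exists f : V -> R,
         [/\ norm2 m f = 1, forall x, x \notin X -> f x = 0 &
             r = energy P m f f]].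

Definition theta (s t : R) : R :=
  if s == t then s else (s - t) / (ln s - ln t).

Definition alpha_spectral (P : V -> V -> R) (m : V -> R) : R :=
  inf [set r | exists X : {set V},
         [/\ X != finset.set0, X != finset.setTfor V &
             r = theta (lambdaD P m X) (lambdaD P m (~: X))]].

End Defs.

(* Main.v *)
(* Write D for the diameter. For nonempty K, curvature >= 0 yields a 1-Lipschitz f
   which off K is a McShane extension f y = min_{k in K} (f k + d k y), and a
   constant C with Lap f approximately equal to C on K. Along geodesics into K the
   function f has full slope, so curvature gives Lap f <= C (approximately) off K.
   By Barta's supersolution principle, D - f bounds the Dirichlet eigenvalue of K
   below by C / D, and a profile 1 - exp (- b f) bounds that of the complement,
   the second-order term P0 coming from the descending neighbour. Depending on the
   size of C, this bounds either the logarithmic mean of the two eigenvalues or the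
   eigenvalue of the complement; in the second case exchange K and its complement. *)
Require Import Defs.
From HB Require Import structures.
From mathcomp Require Import all_boot all_order all_algebra.
From mathcomp Require Import all_classical all_reals.
From mathcomp Require Import exp.
From mathcomp Require Import topology normedtype sequences lra ring.
Import Order.TTheory GRing.Theory Num.Theory.
Import numFieldNormedType.Exports.
Local Open Scope ring_scope.

Set Implicit Arguments.
Unset Strict Implicit.
Unset Printing Implicit Defensive.

(** * Elementary bounds for the exponential *)

Lemma expR_ge_taylor2 (R : realType) (x : R) :
  0 <= x -> 1 + x + x ^+ 2 / 2 <= expR x.
Proof.
move=> x0.
have -> : 1 + x + x ^+ 2 / 2 = series (exp_coeff x) 3.
  rewrite /series /= !big_nat_recr //= big_nil /exp_coeff /=.
  by rewrite !expr0 expr1 !divr1 add0r.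
apply: nondecreasing_cvgn_le; last exact: is_cvg_series_exp_coeff.
apply/nondecreasing_seqP => n; rewrite /series /= big_nat_recr //= lerDl.
by rewrite /exp_coeff /= divr_ge0 ?exprn_ge0.
Qed.

(** Applied with prefactor [3 * L], so any bound of at least 1/3 is enough; [(7 / 8) ^+ 8] just
    exceeds it. *)
Lemma expRN1_ge (R : realType) : (17 / 50 : R) <= expR (- 1).
Proof.
have -> : -1 = 8%:R * (- (1 / 8)) :> R by lra.
rewrite expRM_natl; apply: (@le_trans _ _ ((7 / 8) ^+ 8)); first by lra.
apply: lerXn2r; rewrite ?nnegrE ?expR_ge0; [lra | by [] |].
by apply: le_trans (expR_ge1Dx _); lra.
Qed.

Lemma exprn_small (R : realType) (r A e : R) :
  0 <= r < 1 -> 0 < e -> exists n, r ^+ n * A <= e.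
Proof.
move=> /andP[r0 r1] e0.
have Nr : `|r| < 1 by rewrite ger0_norm.
have e1 : 0 < e / (`|A| + 1) by rewrite divr_gt0 // ltr_wpDl.
have /cvgrPdist_le/(_ _ e1)[n _ /(_ n (leqnn n))] := cvg_expr Nr.
rewrite /= sub0r normrN ger0_norm ?exprn_ge0 // => le; exists n.
have := @ler_wpM2r _ (`|A| + 1) _ _ _ le.
rewrite mulfVK ?gt_eqF ?ltr_wpDl // => /(_ _).
rewrite addr_ge0 // => /(_ isT); apply: le_trans.
by rewrite ler_wpM2l ?exprn_ge0 // (le_trans (ler_norm A)) // lerDl.
Qed.

(** * The logarithmic mean *)

Lemma thetaC (R : realType) (s t : R) : theta s t = theta t s.
Proof.
rewrite /theta eq_sym; case: eqVneq => [-> //|_].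
by rewrite -[s - t]opprB -[ln s - ln t]opprB invrN mulrNN.
Qed.

Lemma ler_lnB (R : realType) (s t : R) : 0 < s -> 0 < t -> ln s - ln t <= s / t - 1.
Proof.
move=> s0 t0; rewrite -ln_div ?posrE //.
rewrite -{1}(subrK 1 (s / t)) addrC; apply: le_ln1Dx.
by rewrite ltrBrDl subrr divr_gt0.
Qed.

(* [x |-> x - L ln x] decreases on ]0, L] and increases on [L, +oo[. *)
Lemma theta_ge_lt (R : realType) (L s s0 t t0 : R) :
  0 < L -> L <= s0 -> s0 <= s -> 0 < t0 -> t0 <= t -> t < s ->
  L * (ln s0 - ln t0) <= s0 - t0 -> L <= theta s t.
Proof.
move=> L0 Ls0 s0s t00 t0t ts H.
have t_gt0 : 0 < t by exact: lt_le_trans t0t.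
have s_gt0 : 0 < s by exact: lt_trans ts.
have s00 : 0 < s0 by exact: lt_le_trans Ls0.
rewrite /theta gt_eqF //.
rewrite ler_pdivlMr ?subr_gt0 ?ltr_ln ?posrE //.
have [Lt|tL] := leP L t.
  have := @ler_lnB _ s t s_gt0 t_gt0.
  move=> /(@ler_wpM2l _ L (ltW L0)) /le_trans; apply.
  have -> : s - t = t * (s / t - 1) by field; rewrite gt_eqF.
  by rewrite ler_wpM2r // subr_ge0 ler_pdivlMr // mul1r ltW.
have A : L * (ln s - ln s0) <= s - s0.
  have := @ler_lnB _ s s0 s_gt0 s00.
  move=> /(@ler_wpM2l _ L (ltW L0)) /le_trans; apply.
  have -> : s - s0 = s0 * (s / s0 - 1) by field; rewrite gt_eqF.
  by rewrite ler_wpM2r // subr_ge0 ler_pdivlMr // mul1r.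
have B : t - t0 <= L * (ln t - ln t0).
  have := @ler_lnB _ t0 t t00 t_gt0.
  move=> /(@ler_wpM2l _ L (ltW L0)) C.
  have : t * (t0 / t - 1) >= L * (t0 / t - 1).
    rewrite -subr_ge0 -mulrBl; apply: mulr_le0.
      by rewrite subr_le0 ltW.
    by rewrite subr_le0 ler_pdivrMr // mul1r.
  have -> : t * (t0 / t - 1) = t0 - t by field; rewrite gt_eqF.
  lra.
lra.
Qed.

Lemma theta_ge (R : realType) (L s s0 t t0 : R) :
  0 < L -> L <= s0 -> s0 <= s -> 0 < t0 -> t0 <= t ->
  L * (ln s0 - ln t0) <= s0 - t0 -> L <= theta s t.
Proof.
move=> L0 Ls0 s0s t00 t0t H.
have [st|ts|/eqP eqst] := ltrgtP s t.
(* Both values are at least [L] here, so after swapping they serve as their own lower bounds. *)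
- have Ls : L <= s by exact: le_trans s0s.
  rewrite thetaC; apply: (@theta_ge_lt _ L t t s s) => //; last 2 first.
  - exact: lt_le_trans Ls.
  - have := @ler_lnB _ t s (lt_trans (lt_le_trans L0 Ls) st) (lt_le_trans L0 Ls).
    move=> /(@ler_wpM2l _ L (ltW L0)) /le_trans; apply.
    have s_gt0 := lt_le_trans L0 Ls.
    have -> : t - s = s * (t / s - 1) by field; rewrite gt_eqF.
    by rewrite ler_wpM2r // subr_ge0 ler_pdivlMr // mul1r ltW.
  - exact: le_trans (ltW st).
- exact: (@theta_ge_lt _ L s s0 t t0).
- by rewrite /theta eqst (le_trans Ls0).
Qed.

Lemma theta_ge_min (R : realType) (L s t : R) :
  0 < L -> L <= s -> L <= t -> L <= theta s t.
Proof.
by move=> L0 Ls Lt; apply: (@theta_ge _ L s L t L) => //; rewrite !subrr mulr0.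
Qed.

(** * Path metrics on a finite graph *)

Section PathDistance.
Variables (R : realType) (V : finType) (P d : V -> V -> R).
Hypothesis dP : path_distance P d.

Let d_sym x y : d x y = d y x. Proof. by case: dP. Qed.

Let d_gt0 x y : x != y -> 0 < d x y. Proof. by case: dP => _ [+ _]; apply. Qed.

Lemma path_length_cons x y p :
  path_length d x (y :: p) = d x y + path_length d y p.
Proof. by rewrite /path_length /= big_cons. Qed.

Lemma path_length_cat x p q :
  path_length d x (p ++ q) = path_length d x p + path_length d (last x p) q.
Proof.
elim: p x => [|z p IH] x /=; first by rewrite {2}/path_length big_nil add0r.
by rewrite !path_length_cons IH addrA.
Qed.

Lemma path_length_ge0 x p : path (adj P) x p -> 0 <= path_length d x p.
Proof.
elim: p x => [|y p IH] x /=; first by rewrite /path_length big_nil.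
move=> /andP[/andP[xy _] yp].
by rewrite path_length_cons addr_ge0 ?IH // ltW // d_gt0.
Qed.

Lemma dist_le_path x p : path (adj P) x p -> d x (last x p) <= path_length d x p.
Proof.
move=> xp; case: dP => _ [_ ->]; apply: ge_inf; last by exists p.
by exists 0 => _ [q [xq _ ->]]; exact: path_length_ge0.
Qed.

Lemma dist_id x : d x x = 0.
Proof.
apply/eqP; rewrite eq_le; apply/andP; split.
  by have := @dist_le_path x [::] isT; rewrite /path_length big_nil.
case: dP => _ [_ ->]; apply: lb_le_inf.
  by exists 0, [::]; split => //; rewrite /path_length big_nil.
by move=> _ [q [xq _ ->]]; exact: path_length_ge0.
Qed.

(* If no path joins [x] to [y], then [d x y] is the infimum of the empty set,
   the junk value 0, against [0 < d x y]. *)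
Lemma adj_connected x y : exists p, path (adj P) x p /\ last x p = y.
Proof.
have [->|xy] := eqVneq x y; first by exists [::].
apply: contrapT => no_path; have := d_gt0 xy; case: dP => _ [_ ->].
rewrite [X in inf X](_ : _ = classical_sets.set0) ?inf0 ?ltxx //.
by apply/seteqP; split => // r [p [xp pl _]]; apply: no_path; exists p.
Qed.

Lemma le_dist x y a :
  (forall p, path (adj P) x p -> last x p = y -> a <= path_length d x p) ->
  a <= d x y.
Proof.
move=> H; case: dP => _ [_ ->]; apply: lb_le_inf.
  by have [p [xp pl]] := adj_connected x y; exists (path_length d x p), p.
by move=> _ [p [xp pl ->]]; exact: H.
Qed.

Lemma dist_ge0 x y : 0 <= d x y.
Proof. by apply: le_dist => p xp _; exact: path_length_ge0. Qed.

Lemma dist_triangle x y z : d x z <= d x y + d y z.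
Proof.
rewrite -lerBlDr; apply: le_dist => p xp pl.
rewrite lerBlDr -lerBlDl; apply: le_dist => q yq ql.
rewrite lerBlDl.
have := @dist_le_path x (p ++ q).
by rewrite cat_path xp path_length_cat last_cat pl yq ql; apply.
Qed.

(* The infimum over paths leaving [x] is a minimum over the first step, because
   there are only finitely many neighbours. *)
Lemma dist_first_step x k :
  x != k -> exists2 z, adj P x z & d x z + d z k <= d x k.
Proof.
move=> xk; have [[|z0 p] [/= xp pl]] := adj_connected x k.
  by rewrite pl eqxx in xk.
have /andP[xz0 _] := xp.
have [z xz zmin] := @arg_minP _ _ _ z0 (adj P x) (fun z => d x z + d z k) xz0.
exists z => //; apply: le_dist => -[|w q] /=.
  by move=> _ xk'; rewrite xk' eqxx in xk.
move=> /andP[xw wq] ql; apply: le_trans (zmin w xw) _.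
by rewrite path_length_cons lerD2l -ql dist_le_path.
Qed.

(** Summing along paths reduces the Lipschitz condition to edges, where curvature is available. *)
Lemma Lip1_edges (f : V -> R) :
  (forall x y, adj P x y -> `|f y - f x| <= d x y) -> Lip1 d f.
Proof.
move=> H x y; apply: le_dist => p; elim: p x => [|z p IH] x /=.
  by move=> _ ->; rewrite subrr normr0 /path_length big_nil.
move=> /andP[xz zp] pl; rewrite path_length_cons.
have -> : f y - f x = (f z - f x) + (f y - f z) by ring.
by apply: le_trans (ler_normD _ _) _; rewrite lerD ?H ?IH.
Qed.

Lemma Lip1_le (f : V -> R) : (forall x y, f y - f x <= d x y) -> Lip1 d f.
Proof.
by move=> H x y; rewrite ler_norml lerNl opprB [d x y]d_sym H -d_sym H.
Qed.

Lemma diam_ge x y : d x y <= diam d.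
Proof.
apply: le_trans (le_bigmax 0 (fun x => \big[Num.max/0]_(y : V) d x y) x).
exact: le_bigmax 0 (d x) y.
Qed.

End PathDistance.

(** * Laplacians of Lipschitz functions and curvature *)

Section LipLap.
Variables (R : realType) (V : finType) (P d : V -> V -> R).
Hypothesis PM : markov_kernel P.
Hypothesis dP : path_distance P d.

Lemma LapZ (a : R) (f : V -> R) x : Lap P (fun y => a * f y) x = a * Lap P f x.
Proof. by rewrite /Lap mulr_sumr; apply: eq_bigr => y _; ring. Qed.

Lemma LapE (f : V -> R) x : Lap P f x = \sum_y P x y * f y - f x.
Proof.
rewrite /Lap; under eq_bigr do rewrite mulrBr.
by rewrite sumrB -mulr_suml PM.2 mul1r.
Qed.

Lemma mean_le (f : V -> R) (M : R) x :
  (forall y, f y <= M) -> \sum_y P x y * f y <= M.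
Proof.
move=> fM; rewrite -[leRHS]mul1r -(PM.2 x) mulr_suml.
by apply: ler_sum => y _; rewrite ler_wpM2l ?PM.1.
Qed.

Lemma mean_ge (f : V -> R) (M : R) x :
  (forall y, M <= f y) -> M <= \sum_y P x y * f y.
Proof.
move=> fM; rewrite -[leLHS]mul1r -(PM.2 x) mulr_suml.
by apply: ler_sum => y _; rewrite ler_wpM2l ?PM.1.
Qed.

Lemma Lap_Lip1_bound (f : V -> R) x : Lip1 d f -> `|Lap P f x| <= diam d.
Proof.
move=> fL; rewrite /Lap ler_norml; apply/andP; split.
  apply: mean_ge => y; have := fL x y; rewrite ler_norml => /andP[+ _].
  by apply: le_trans; rewrite lerN2 diam_ge.
apply: mean_le => y; have := fL x y; rewrite ler_norml => /andP[_].
by move/le_trans; apply; exact: diam_ge.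
Qed.

(** The form in which curvature enters. [Lap_Lip1_bound] bounds the quotients below, so [kappa]
    really is a lower bound for them. *)
Lemma kappa_ge0_Lap (f : V -> R) x y : x != y -> 0 <= kappa P d x y ->
  Lip1 d f -> f y - f x = d x y -> Lap P f y <= Lap P f x.
Proof.
move=> xy k0 fL fxy; have dxy : 0 < d x y by case: dP => _ [+ _]; apply.
rewrite -subr_ge0 -(pmulr_lge0 _ (x := (d x y)^-1)) ?invr_gt0 //.
apply: le_trans k0 _; apply: ge_inf; last by exists f.
exists (- (diam d + diam d) / d x y) => _ [g [gL _ ->]].
rewrite ler_pM2r ?invr_gt0 //.
have := Lap_Lip1_bound x gL; have := Lap_Lip1_bound y gL.
rewrite !ler_norml; lra.
Qed.

End LipLap.

(** * Lipschitz potentials with nearly constant Laplacian on a set *)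

Section Separation.
Variables (R : realType) (V : finType) (P d : V -> V -> R).
Hypothesis PM : markov_kernel P.
Hypothesis PS : symmetric_support P.
Hypothesis dP : path_distance P d.
Hypothesis curv : forall x y, adj P x y -> 0 <= kappa P d x y.

Let d_sym x y : d x y = d y x. Proof. by case: dP. Qed.

Let d_gt0 x y : x != y -> 0 < d x y. Proof. by case: dP => _ [+ _]; apply. Qed.

Let adj_sym x y : adj P x y -> adj P y x.
Proof. by rewrite /adj eq_sym => /andP[-> /PS ->]. Qed.

Let Lip1_lerD (f : V -> R) x y : Lip1 d f -> f y <= f x + d x y.
Proof. by move=> /(_ x y) /(le_trans (ler_norm _)); rewrite lerBlDl. Qed.

(** One step of the lazy walk, with averaging operator [(I + P) / 2]. *)
Definition half_step (f : V -> R) (x : V) : R := f x + Lap P f x / 2.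

Lemma half_stepE f x : half_step f x = (f x + \sum_y P x y * f y) / 2.
Proof. by rewrite /half_step LapE //; lra. Qed.

(* The curvature condition only concerns functions with full slope between [x]
   and [y]: raise [f] to such a function [g]. At [y] this costs at most what the
   laziness 1/2 of the step gives back. *)
Lemma half_step_Lip1 f : Lip1 d f -> Lip1 d (half_step f).
Proof.
move=> fL; apply: (Lip1_edges dP).
suff H x y : adj P x y -> half_step f y - half_step f x <= d x y.
  move=> x y xy; rewrite ler_norml lerNl opprB (H _ _ xy) andbT d_sym.
  exact/H/adj_sym.
move=> xy; have /andP[xNy _] := xy.
pose g z := Num.max (f z) (f x + d x y - d z y).
have gL : Lip1 d g.
  apply: (Lip1_le dP) => a b; rewrite lerBlDr {1}/g ge_max; apply/andP; split.
    have := Lip1_lerD a b fL; have : f a <= g a by rewrite le_max lexx.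
    lra.
  have := dist_triangle dP a b y.
  have : f x + d x y - d a y <= g a by rewrite le_max lexx orbT.
  lra.
have gx : g x = f x by rewrite /g addrK maxxx.
have gy : g y = f x + d x y.
  by rewrite /g (dist_id dP) subr0; apply/max_idPr; exact: Lip1_lerD.
have fg z : f z <= g z by rewrite le_max lexx.
have gf z : g z <= f z + (f x + d x y - f y).
  have := Lip1_lerD z y fL; have := Lip1_lerD x y fL.
  by rewrite ge_max => H1 H2; apply/andP; split; lra.
have := kappa_ge0_Lap PM dP xNy (curv xy) gL _.
rewrite gx gy !LapE // gx gy addrC addKr => /(_ erefl) HL.
have My : \sum_z P y z * f z <= \sum_z P y z * g z.
  by apply: ler_sum => z _; rewrite ler_wpM2l ?PM.1.
have Mx : \sum_z P x z * g z <= \sum_z P x z * f z + (f x + d x y - f y).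
  rewrite -[X in _ <= _ + X]mul1r -(PM.2 x) mulr_suml -big_split /=.
  by apply: ler_sum => z _; rewrite -mulrDr ler_wpM2l ?PM.1.
(* Put [delta = f x + d x y - f y]. The means differ by at most [d x y + delta] and the values by
   [d x y - delta]; their average is [d x y]. *)
rewrite !half_stepE; lra.
Qed.

Lemma half_step_dist f g (e : R) : (forall x, `|f x - g x| <= e) ->
  forall x, `|half_step f x - half_step g x| <= e.
Proof.
move=> fg x; rewrite !half_stepE.
have : `|\sum_y P x y * f y - \sum_y P x y * g y| <= e.
  rewrite -sumrB; under eq_bigr do rewrite -mulrBr.
  rewrite ler_norml mean_le // ?mean_ge // => y;
    by have := fg y; rewrite ler_norml => /andP[].
have := fg x; rewrite !ler_norml; lra.
Qed.

(** For [k0] in [K], [k0] is just the seed of the arg min, and only the values of [g] on [K]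
    matter. *)
Definition mcshane (K : {set V}) (k0 : V) (g : V -> R) (y : V) : R :=
  let k := [arg min_(k < k0 | k \in K) (g k + d k y)]%O in g k + d k y.

Section Extension.
Variables (K : {set V}) (k0 : V).
Hypothesis k0K : k0 \in K.

Lemma mcshaneP g y : exists2 k, k \in K & mcshane K k0 g y = g k + d k y.
Proof. by rewrite /mcshane; case: arg_minP => // k kK _; exists k. Qed.

Lemma mcshane_le g y k : k \in K -> mcshane K k0 g y <= g k + d k y.
Proof. by move=> kK; rewrite /mcshane; case: arg_minP => // i _; apply. Qed.

Lemma mcshane_Lip1 g : Lip1 d (mcshane K k0 g).
Proof.
apply: (Lip1_le dP) => x y; have [k kK ->] := mcshaneP g x.
have := mcshane_le g y kK; have := dist_triangle dP k x y; lra.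
Qed.

Lemma mcshane_id g k : Lip1 d g -> k \in K -> mcshane K k0 g k = g k.
Proof.
move=> gL kK; apply/eqP; rewrite eq_le; apply/andP; split.
  by apply: le_trans (mcshane_le g k kK) _; rewrite (dist_id dP) addr0.
by have [j jK ->] := mcshaneP g k; exact: Lip1_lerD.
Qed.

Lemma mcshane_dist f g (e : R) : (forall x, `|f x - g x| <= e) ->
  forall x, `|mcshane K k0 f x - mcshane K k0 g x| <= e.
Proof.
move=> fg x; have [k kK fk] := mcshaneP f x; have [j jK gj] := mcshaneP g x.
have := mcshane_le g x kK; have := mcshane_le f x jK.
have := fg k; have := fg j; rewrite !ler_norml fk gj; lra.
Qed.

(* A nonlinear eigenvalue problem [mcshane (half_step f) = f + const]: for
   discount [r < 1] the map [step] is a strict contraction, so its iterates are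
   approximate fixed points; let [r] be close to 1. *)
Lemma Lap_almost_constant (e : R) : 0 < e ->
  exists f C, [/\ Lip1 d f,
    forall y, exists2 k, k \in K & f y = f k + d k y &
    forall k, k \in K -> C <= Lap P f k <= C + e].
Proof.
move=> e0; have D0 : 0 <= diam d := le_trans (dist_ge0 dP k0 k0) (diam_ge d k0 k0).
(* Chosen so that [q <= 1 / 2], hence [r / 2 >= 1 / 4], and [q * diam d <= e / 8]. *)
pose q := e / (8 * diam d + 2 * e).
have den0 : 0 < 8 * diam d + 2 * e by lra.
have q0 : 0 < q by rewrite divr_gt0.
have q2 : q <= 1 / 2 by rewrite ler_pdivrMr //; lra.
have qD : q * diam d <= e / 8.
  by rewrite /q mulrAC ler_pdivrMr // -mulrA ler_pM2l //; lra.
pose r := 1 - q.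
have r01 : 0 <= r < 1 by rewrite /r; lra.
have [r0 r1] := andP r01.
have rL f : Lip1 d f -> Lip1 d (fun x => r * f x).
  move=> fL x y; rewrite -mulrBr normrM ger0_norm //.
  by apply: le_trans (fL x y); rewrite ler_piMl // ltW.
pose step (f : V -> R) : V -> R := mcshane K k0 (half_step (fun x => r * f x)).
pose F n : V -> R := iter n step (fun=> 0).
have FL n : Lip1 d (F n).
  case: n => [|n]; last exact: mcshane_Lip1.
  by move=> x y; rewrite subrr normr0 (dist_ge0 dP).
pose A : R := \sum_x `|F 1%N x|.
have FA n x : `|F n.+1 x - F n x| <= r ^+ n * A.
  elim: n x => [|n IH] x.
    rewrite expr0 mul1r /= subr0 /A (bigD1 x) //= lerDl.
    by apply: sumr_ge0 => ? _.
  apply: mcshane_dist; apply: half_step_dist => y.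
  by rewrite -mulrBr normrM ger0_norm // exprS -mulrA ler_wpM2l //; exact: IH.
have e16 : 0 < e / 16 by lra.
have [n An] := exprn_small (r * A) r01 e16.
(* The index is a successor so that [f] is itself an extension from [K]. *)
pose f := F n.+1.
have LapK k : k \in K -> r / 2 * Lap P f k = (F n.+2 k - f k) + q * f k.
  move=> kK; have -> : F n.+2 k = half_step (fun x => r * f x) k.
    exact: (mcshane_id (half_step_Lip1 (rL _ (FL n.+1))) kK).
  by rewrite /half_step LapZ /r; ring.
have FF k : `|F n.+2 k - f k| <= e / 16.
  by apply: le_trans (FA n.+1 k) _; rewrite exprSr -mulrA; exact: An.
(* The term [q * f k] may be large, but it varies by at most [e / 8]; with two errors [e / 16] this
   makes [e / 4], against the factor 1/4. *)
have osc k j : k \in K -> j \in K -> Lap P f k - Lap P f j <= e.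
  move=> kK jK; rewrite leNgt; apply/negP => lt_e.
  have : q * (f k - f j) <= e / 8.
    apply: le_trans qD; rewrite ler_pM2l //.
    apply: le_trans (diam_ge d j k); apply: le_trans (FL n.+1 j k).
    exact: ler_norm.
  have := FF k; have := FF j; rewrite !ler_norml.
  have := LapK k kK; have := LapK j jK.
  have : (1 / 4) * e < r / 2 * (Lap P f k - Lap P f j).
    apply: (@lt_le_trans _ _ ((1 / 4) * (Lap P f k - Lap P f j))); first by lra.
    by rewrite ler_wpM2r // /r; lra.
  lra.
have [k kK kmin] := @arg_minP _ _ _ k0 (mem K) (Lap P f) k0K.
exists f, (Lap P f k); split => [||j jK]; first exact: FL.
  move=> y; have [j jK fy] := mcshaneP (half_step (fun x => r * F n x)) y.
  exists j => //.
  have fj : f j = half_step (fun x => r * F n x) j.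
    exact: (mcshane_id (half_step_Lip1 (rL _ (FL n))) jK).
  by rewrite fj -fy.
by have := osc j k jK kK; rewrite (kmin j jK) /=; lra.
Qed.

End Extension.

(** Take [z] as the first step of a geodesic from [y] to [k]: the Lipschitz bounds from [k] and from
    [y] pinch [f z]. *)
Lemma descent (f : V -> R) k y : Lip1 d f -> y != k -> f y = f k + d k y ->
  exists z, [/\ adj P y z, f z = f y - d y z, f z = f k + d k z &
                d z k < d y k].
Proof.
move=> fL yk fy; have [z yz dz] := dist_first_step dP yk.
have /andP[yNz _] := yz; exists z.
have := Lip1_lerD k z fL; have := Lip1_lerD z y fL; have := d_gt0 yNz.
rewrite (d_sym z y) fy (d_sym k y) (d_sym k z); split=> //; lra.
Qed.

(** Each descent step has full slope, so by curvature the Laplacian does not decrease on the way to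
    [k]. *)
Lemma Lap_le_source (f : V -> R) k y : Lip1 d f -> f y = f k + d k y ->
  Lap P f y <= Lap P f k.
Proof.
(* Distances are real, so the induction counts the vertices strictly closer to [k]. *)
move=> fL; have [n] := ubnP #|[set z | d z k < d y k]|.
elim: n y => // n IH y; rewrite ltnS => yn fy.
have [-> //|yk] := eqVneq y k.
have [z [yz fzy fz zk]] := descent fL yk fy.
apply: (@le_trans _ _ (Lap P f z)).
  have /andP[yNz _] := yz.
  apply: (kappa_ge0_Lap PM dP) (curv (adj_sym yz)) fL _; first by rewrite eq_sym.
  by rewrite fzy d_sym; lra.
apply: IH fz; apply: leq_trans yn; apply: proper_card; apply/properP; split.
  by apply/fintype.subsetP => w; rewrite !inE => /lt_trans; apply.
by exists z; rewrite !inE ?ltxx.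
Qed.

End Separation.

(** * Dirichlet eigenvalue bounds *)

Section Spectral.
Variables (R : realType) (V : finType) (P d : V -> V -> R) (m : V -> R).
Hypothesis PM : markov_kernel P.
Hypothesis PS : symmetric_support P.
Hypothesis dP : path_distance P d.
Hypothesis mP : reversible_probability P m.

Let m_ge0 x : 0 <= m x. Proof. by case: mP. Qed.

(** Some vertex has mass; detailed balance carries positivity along paths. *)
Lemma reversible_probability_gt0 x : 0 < m x.
Proof.
have [m0 m1 mrev] := mP.
have [x0 mx0] : exists x0, 0 < m x0.
  apply: contrapT => no; move: m1; rewrite big1 => [/esym/eqP|y _].
    by rewrite oner_eq0.
  by apply/eqP; rewrite eq_le m_ge0 andbT leNgt; apply/negP => my; apply: no; exists y.
have [p [x0p <-]] := adj_connected dP x0 x.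
elim: p x0 mx0 x0p => [|z p IH] y my //= /andP[/andP[_ yz] zp].
apply: IH zp; rewrite lt_def m_ge0 andbT; apply/eqP => mz0.
have := mrev y z; rewrite mz0 mul0r => /eqP.
by rewrite mulf_eq0 !gt_eqF.
Qed.

Lemma reversible_sum_swap (F : V -> V -> R) :
  \sum_x \sum_y m x * P x y * F x y = \sum_x \sum_y m x * P x y * F y x.
Proof.
have [_ _ mrev] := mP.
by rewrite exchange_big; apply: eq_bigr => x _; apply: eq_bigr => y _; rewrite mrev.
Qed.

Lemma energyE (f g : V -> R) : energy P m f g =
  \sum_x m x * (f x * g x) - \sum_x \sum_y m x * P x y * (g x * f y).
Proof.
rewrite /energy /inner -sumrN -sumrB; apply: eq_bigr => x _.
rewrite LapE // mulrBl mulrBl opprB; congr (_ - _); first by ring.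
rewrite !mulr_suml; apply: eq_bigr => y _; ring.
Qed.

(* Barta's argument: test the supersolution [u] against [h ^+ 2 / u]. *)
Lemma energy_ge_supersolution (X : {set V}) (u h : V -> R) :
  (forall x, 0 <= u x) -> (forall x, x \in X -> 0 < u x) ->
  (forall x, x \notin X -> h x = 0) ->
  energy P m u (fun x => h x ^+ 2 / u x) <= energy P m h h.
Proof.
move=> u0 uX hX; rewrite !energyE; apply: lerB.
  apply: ler_sum => x _; rewrite ler_wpM2l //.
  have [/uX ux|/hX ->] := boolP (x \in X); last by rewrite expr0n !mul0r mulr0.
  by rewrite mulrC divfK ?gt_eqF.
set S1 := (X in X <= _); set S2 := (X in _ <= X).
(* The termwise inequality, a perfect square, holds only after symmetrizing in [x] and [y] by
   reversibility. *)
suff : S1 + S1 <= S2 + S2 by lra.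
rewrite {2}/S2 reversible_sum_swap /S1 /S2 -!big_split /=.
apply: ler_sum => x _; rewrite -!big_split /=; apply: ler_sum => y _.
have w0 z : 0 <= h z ^+ 2 / u z by rewrite divr_ge0 ?sqr_ge0.
suff key : h x * h y + h x * h y <= h x ^+ 2 / u x * u y + h y ^+ 2 / u y * u x.
  rewrite -[leLHS]mulrDr -[leRHS]mulrDr.
  by rewrite ler_wpM2l ?mulr_ge0 ?PM.1.
have wu0 : 0 <= h x ^+ 2 / u x * u y + h y ^+ 2 / u y * u x.
  by rewrite addr_ge0 // mulr_ge0.
have [/uX ux|/hX hx] := boolP (x \in X); last first.
  by apply: le_trans wu0; rewrite hx mul0r addr0.
have [/uX uy|/hX hy] := boolP (y \in X); last first.
  by apply: le_trans wu0; rewrite hy mulr0 addr0.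
rewrite -subr_ge0.
have -> : h x ^+ 2 / u x * u y + h y ^+ 2 / u y * u x - (h x * h y + h x * h y)
   = (h x * u y - h y * u x) ^+ 2 / (u x * u y).
  by field; rewrite !gt_eqF.
by rewrite divr_ge0 ?sqr_ge0 // mulr_ge0 // ltW.
Qed.

Lemma lambdaD_ge (X : {set V}) (u : V -> R) (mu M : R) :
  X != finset.set0 -> 0 < mu -> 0 < M -> (forall x, 0 <= u x <= M) ->
  (forall x, x \in X -> mu <= - Lap P u x) -> mu / M <= lambdaD P m X.
Proof.
move=> /set0Pn[x0 x0X] mu0 M0 uM Lu.
have u0 x : 0 <= u x by case/andP: (uM x).
(* A zero of [u] would be a minimum, where [- Lap P u] cannot be positive. *)
have uX x : x \in X -> 0 < u x.
  move=> xX; rewrite lt_def u0 andbT; apply/eqP => ux0.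
  have := lt_le_trans mu0 (Lu x xX); rewrite LapE // ux0 subr0 oppr_gt0 ltNge.
  by rewrite mean_ge.
apply: lb_le_inf => [|_ [h [h1 hX ->]]].
  (* A normalized point mass shows that the infimum is not over the empty set. *)
  pose h x := if x == x0 then (Num.sqrt (m x0))^-1 else 0.
  exists (energy P m h h), h; split => // [|x xX]; last first.
    by rewrite /h; case: eqP => // xx0; rewrite xx0 x0X in xX.
  rewrite /norm2 /inner (bigD1 x0) //= big1 => [|x /negbTE xx0]; last first.
    by rewrite /h xx0 !mul0r.
  have sm : 0 < Num.sqrt (m x0) by rewrite sqrtr_gt0 reversible_probability_gt0.
  rewrite /h eqxx addr0 -{3}[m x0]sqr_sqrtr // expr2 mulrA -[_ * _ * _ in X in X * _]mulrA.
  by rewrite mulVf ?gt_eqF // mulr1 mulVf ?gt_eqF // sqrtr1.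
have hh : inner m h h = 1.
  have i0 : 0 <= inner m h h by apply: sumr_ge0 => x _; rewrite mulr_ge0 // -expr2 sqr_ge0.
  by rewrite -[LHS]sqr_sqrtr // -/(norm2 m h) h1 expr1n.
apply: le_trans (energy_ge_supersolution u0 uX hX).
rewrite -[leLHS]mulr1 -hh /energy /inner -sumrN mulr_sumr.
apply: ler_sum => x _; rewrite -!mulNr mulrA ler_wpM2r //.
have [xX|/hX ->] := boolP (x \in X); last by rewrite expr0n !mul0r !mulr0.
have ux := uX x xX.
apply: (@le_trans _ _ (mu * (h x ^+ 2 / u x))); last first.
  by rewrite ler_wpM2r ?Lu // divr_ge0 ?sqr_ge0 // ltW.
rewrite -mulrA ler_pM2l // mulrC expr2 ler_wpM2l -?expr2 ?sqr_ge0 //.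
by rewrite lef_pV2 ?posrE //; case/andP: (uM x).
Qed.

Lemma P0_le x y : adj P x y -> P0 P d <= P x y * d x y ^+ 2.
Proof.
move=> xy; apply: ge_inf; last by exists x, y.
by exists 0 => _ [a [b [_ ->]]]; rewrite mulr_ge0 ?sqr_ge0 ?PM.1.
Qed.

(** With an edge present, the infimum is a minimum over finitely many positive numbers. *)
Lemma P0_gt0 x y : adj P x y -> 0 < P0 P d.
Proof.
move=> xy; pose F (ab : V * V) := P ab.1 ab.2 * d ab.1 ab.2 ^+ 2.
have [[a b] /= ab abmin] := @arg_minP _ _ _ (x, y) (fun ab => adj P ab.1 ab.2) F xy.
apply: (@lt_le_trans _ _ (F (a, b))).
  case/andP: ab => aNb Pab; rewrite mulr_gt0 // exprn_gt0 //.
  by case: dP => _ [+ _]; apply.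
apply: lb_le_inf; first by exists (F (x, y)), x, y.
by move=> _ [a' [b' [ab' ->]]]; exact: (abmin (a', b')).
Qed.

(* The exponential is convex, and the descending neighbour [z] contributes a
   second-order term at least [b ^+ 2 * P0 / 2]. *)
Lemma Lap_exp_profile (f : V -> R) (a b C : R) y z :
  0 < b -> adj P y z -> f z = f y - d y z -> Lap P f y <= C ->
  (b ^+ 2 * P0 P d / 2 - b * C) * expR (- (b * (f y - a))) <=
  - Lap P (fun x => 1 - expR (- (b * (f x - a)))) y.
Proof.
move=> b0 yz fz fC; set E := expR _.
have -> : - Lap P (fun x => 1 - expR (- (b * (f x - a)))) y =
    (\sum_w P y w * (expR (b * (f y - f w)) - 1)) * E.
  rewrite /Lap -sumrN mulr_suml; apply: eq_bigr => w _.
  have -> : - (b * (f w - a)) = b * (f y - f w) + - (b * (f y - a)) by ring.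
  by rewrite expRD -/E; ring.
rewrite ler_wpM2r ?expR_ge0 // (bigD1 z) //= fz opprB subrKC.
apply: (@le_trans _ _ (b ^+ 2 * (P y z * d y z ^+ 2) / 2 - b * Lap P f y)).
  apply: lerB; last by rewrite ler_pM2l.
  by rewrite ler_pM2r ?invr_gt0 // ler_pM2l ?exprn_gt0 // P0_le.
have -> : - (b * Lap P f y) = P y z * (b * d y z) +
    \sum_(w | w != z) P y w * (b * (f y - f w)).
  rewrite /Lap (bigD1 z) //= fz mulrDr opprD mulr_sumr -sumrN; congr (_ + _).
    by ring.
  by apply: eq_bigr => w _; ring.
rewrite addrA; apply: lerD.
  have bd : 0 <= b * d y z by rewrite mulr_ge0 ?(dist_ge0 dP) // ltW.
  have := ler_wpM2l (PM.1 y z) (expR_ge_taylor2 bd); lra.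
apply: ler_sum => w _; rewrite ler_wpM2l ?PM.1 //.
by rewrite lerBrDl expR_ge1Dx.
Qed.

Hypothesis curv : forall x y, adj P x y -> 0 <= kappa P d x y.

(* When [C] is large, [lambdaD K >= C / D], and the profile with rate [4 * C / p]
   loses only the factor [exp (- 4 * C * D / p)] on [~: K], which the logarithm in
   [theta] absorbs. When [C] is small, the rate [1 / D] bounds [lambdaD (~: K)]
   alone. *)
Lemma lambdaD_dichotomy (K : {set V}) : K != finset.set0 -> K != finset.setT ->
  let L := P0 P d / (16 * diam d ^+ 2) in 0 < L /\
  (L <= theta (lambdaD P m K) (lambdaD P m (~: K)) \/ L <= lambdaD P m (~: K)).
Proof.
move=> K0 KT; have [k0 k0K] := set0Pn _ K0.
have Kc0 : ~: K != finset.set0 by rewrite -finset.setCT (inj_eq (@finset.setC_inj V)).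
have [y0 y0K] := set0Pn _ Kc0; rewrite inE in y0K.
have y0k0 : y0 != k0 by apply: contraNneq y0K => ->.
have [z0 y0z0 _] := dist_first_step dP y0k0.
have p0 := P0_gt0 y0z0; set p := P0 P d in p0 *.
have D0 : 0 < diam d.
  by apply: lt_le_trans (diam_ge d y0 k0); case: dP => _ [+ _]; apply.
set D := diam d in D0 *.
have e0 : 0 < p / (16 * D) by rewrite divr_gt0 // mulr_gt0.
have [f [C [fL fK fC]]] := Lap_almost_constant PM PS dP curv k0K e0.
set e := p / (16 * D) in e0 fC.
have [x0 _ x0min] := @arg_minP _ _ _ k0 predT f isT; set a := f x0 in x0min.
have fa x : 0 <= f x - a <= D.
  rewrite subr_ge0 x0min //=; apply: le_trans (diam_ge d x0 x).
  exact: le_trans (ler_norm _) (fL x0 x).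
have lamK : 0 < C -> C / D <= lambdaD P m K.
  move=> C0; apply: (@lambdaD_ge K (fun x => D - (f x - a))) => // [x|x xK].
    by have := fa x; lra.
  have -> : Lap P (fun x => D - (f x - a)) x = - Lap P f x.
    by rewrite /Lap -sumrN; apply: eq_bigr => y _; ring.
  by rewrite opprK; case/andP: (fC x xK).
have lamKc b : 0 < b -> 0 < b ^+ 2 * p / 2 - b * (C + e) ->
    (b ^+ 2 * p / 2 - b * (C + e)) * expR (- (b * D)) <= lambdaD P m (~: K).
  move=> b0 mu0; set mu := _ - _ in mu0 *; rewrite -[leLHS]divr1.
  apply: (@lambdaD_ge _ (fun x => 1 - expR (- (b * (f x - a))))) => // [|x|y].
  - by rewrite mulr_gt0 ?expR_gt0.
  - rewrite subr_ge0 expR_le1 oppr_le0 gerBl expR_ge0 andbT mulr_ge0 ?(ltW b0) //.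
    by case/andP: (fa x).
  rewrite inE => yK; have [k kK fy] := fK y.
  have yk : y != k by apply: contraNneq yK => ->.
  have [z [yz fz _ _]] := descent dP fL yk fy.
  have LC : Lap P f y <= C + e.
    apply: le_trans (Lap_le_source PM PS dP curv fL fy) _.
    by case/andP: (fC k kK).
  apply: le_trans (Lap_exp_profile a b0 yz fz LC).
  rewrite ler_pM2l // ler_expR lerN2 ler_pM2l //.
  by case/andP: (fa y).
have D0' : D != 0 by rewrite gt_eqF.
have p0' : p != 0 by rewrite gt_eqF.
set L := p / (16 * D ^+ 2).
have L0 : 0 < L by rewrite divr_gt0 // mulr_gt0 // exprn_gt0.
(* The threshold means [C / D = 4 * L]; the error satisfies [e / D = L]. *)
have [largeC|smallC] := leP (p / (4 * D)) C; split=> //; [left|right].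
  have C0 : 0 < C by apply: lt_le_trans largeC; rewrite divr_gt0 // mulr_gt0.
  pose s := C / D; have s0 : 0 < s by rewrite divr_gt0.
  have Ls : 4 * L <= s.
    have -> : 4 * L = p / (4 * D) / D by rewrite /L; field.
    by rewrite ler_pM2r ?invr_gt0.
  (* Twice the rate at which [b ^+ 2 * p / 2 - b * C] vanishes; it also gives
     [L * (b * D) = s / 4]. *)
  pose b := 4 * C / p; have b0 : 0 < b by rewrite divr_gt0 // mulr_gt0.
  have mu_ge : s / 2 <= b ^+ 2 * p / 2 - b * (C + e).
    have -> : b ^+ 2 * p / 2 - b * (C + e) = s * (s / (4 * L)) - s / 4.
      by rewrite /b /s /e /L; field; rewrite p0' D0'.
    have : s * 1 <= s * (s / (4 * L)).
      by rewrite ler_pM2l // ler_pdivlMr ?mul1r // mulr_gt0.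
    lra.
  have t0 : 0 < s / 2 * expR (- (b * D)) by rewrite mulr_gt0 ?expR_gt0 // divr_gt0.
  (* With [t0 = s / 2 * exp (- b D)], the log condition reads [L * ln 2 + s / 4 <= s - t0]; it holds
     since [L <= s / 4] and [t0 <= s / 2]. *)
  apply: (theta_ge L0 _ (lamK C0) t0); first by rewrite -/s; lra.
    apply: le_trans (lamKc b b0 _); last by lra.
    by rewrite ler_pM2r ?expR_gt0.
  have ln2 : ln 2 <= 1 :> R.
    by have := @ler_lnB R 2 1; rewrite ln1 !subr0 divr1; lra.
  rewrite -/s (@lnM _ (s / 2)) ?posrE ?expR_gt0 ?divr_gt0 //.
  rewrite (@ln_div _ s 2) ?posrE // expRK.
  have -> : ln s - (ln s - ln 2 + - (b * D)) = ln 2 + b * D by ring.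
  have LbD : L * (b * D) = s / 4 by rewrite /L /b /s; field; rewrite p0' D0'.
  have Lln2 : L * ln 2 <= L by rewrite -[leRHS]mulr1 ler_pM2l.
  have : s / 2 * expR (- (b * D)) <= s / 2.
    by rewrite ler_piMr ?divr_ge0 ?ltW // expR_lt1 oppr_lt0 mulr_gt0.
  rewrite mulrDr LbD; lra.
have b0 : 0 < D^-1 by rewrite invr_gt0.
(* The three terms contribute [8 * L], more than [- 4 * L] from [C], and [- L] from [e]. *)
have mu_ge : 3 * L <= D^-1 ^+ 2 * p / 2 - D^-1 * (C + e).
  have -> : D^-1 ^+ 2 * p / 2 - D^-1 * (C + e) = 7 * L - D^-1 * C.
    by rewrite /e /L; field.
  have : D^-1 * C <= D^-1 * (p / (4 * D)) by rewrite ler_pM2l // ltW.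
  have -> : D^-1 * (p / (4 * D)) = 4 * L by rewrite /L; field.
  lra.
apply: le_trans (lamKc D^-1 b0 _); last by lra.
rewrite mulVf //.
apply: (@le_trans _ _ (3 * L * (17 / 50))); first by lra.
by rewrite ler_pM ?expRN1_ge //; lra.
Qed.

End Spectral.

Theorem theorem5p4 (R : realType) (V : finType)
  (P : V -> V -> R) (d : V -> V -> R) (m : V -> R) :
  markov_kernel P ->
  symmetric_support P ->
  path_distance P d ->
  reversible_probability P m ->
  (forall x y, adj P x y -> 0 <= kappa P d x y) ->
  P0 P d / (16 * diam d ^+ 2) <= alpha_spectral P m.
Proof.
move=> PM PS dP mP curv.
have [[X [X0 XT]]|noX] := pselect (exists X : {set V},
  X != finset.set0 /\ X != finset.setT).
- apply: lb_le_inf; first by exists (theta (lambdaD P m X) (lambdaD P m (~: X))), X.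
  move=> _ [{X0 XT}X [X0 XT ->]].
  (* If neither [X] nor its complement settles [theta] directly, both eigenvalues are at least [L],
     hence so is their mean. *)
  have [L0 [//|LXc]] := lambdaD_dichotomy PM PS dP mP curv X0 XT.
  have Xc0 : ~: X != finset.set0 by rewrite -finset.setCT (inj_eq (@finset.setC_inj V)).
  have XcT : ~: X != finset.setT by rewrite -finset.setC0 (inj_eq (@finset.setC_inj V)).
  have [_] := lambdaD_dichotomy PM PS dP mP curv Xc0 XcT.
  rewrite finset.setCK thetaC => -[//|LX]; exact: theta_ge_min.
(* Without proper nonempty subsets there are no edges; both infima are over the empty set, and the
   claim is [0 <= 0]. *)
have no_adj x y : ~ adj P x y.
  move=> /andP[xy _]; apply: noX; exists [set x]; split.
    by apply/set0Pn; exists x; rewrite inE.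
  by apply/eqP => /setP/(_ y); rewrite !inE eq_sym (negbTE xy).
rewrite /P0 /alpha_spectral.
rewrite [X in inf X / _](_ : _ = classical_sets.set0); last first.
  by apply/seteqP; split => // r [x [y [/no_adj]]].
rewrite [X in _ <= inf X](_ : _ = classical_sets.set0) ?inf0 ?mul0r //.
by apply/seteqP; split => // r [X [X0 XT _]]; apply: noX; exists X.
Qed.
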